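(* Let $D$ be a division ring, let $n \ge 1$ be an integer, and let $R$ be a maximal commutative subring of the matrix ring $M_n(D)$. Then $R$ is a direct product of at most $n$ zero-dimensional local rings, and $J(R) = N(R)$.
   Context: A division ring is not assumed to be commutative, nor finite dimensional over its center. $M_n(D)$ is the ring of $n \times n$ matrices over $D$. A maximal commutative subring of $M_n(D)$ is a commutative subring that is maximal with respect to inclusion among all commutative subrings of $M_n(D)$. A local ring is a commutative ring with exactly one maximal ideal (not assumed Noetherian), and zero-dimensional means of Krull dimension $0$. $J(R)$ denotes the Jacobson radical of $R$, and $N(R)$ denotes the nilradical of $R$ (the ideal of nilpotent elements). *)

(* Defs.v *)
From HB Require Import structures.
From mathcomp Require Import all_boot all_algebra.
From mathcomp Require Import boolp classical_sets.

Set Implicit Arguments.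
Unset Strict Implicit.
Unset Printing Implicit Defensive.

Import GRing.Theory.

Local Open Scope classical_set_scope.
Local Open Scope ring_scope.

Section Ideals.
Variable A : comNzRingType.

(* Ideals are arbitrary subsets, membership being turned into a boolean by the
   classical predType structure on [set A].  [idealr_closed] includes
   [1 \notin I], so it characterizes the proper ideals. *)
Definition is_proper_ideal (I : set A) : Prop := idealr_closed [in I].

Definition is_prime_ideal (P : set A) : Prop :=
  is_proper_ideal P /\ prime_idealr_closed [in P].

Definition is_maximal_ideal (M : set A) : Prop :=
  is_proper_ideal M /\
  forall I : set A, is_proper_ideal I -> M `<=` I -> I = M.

Definition is_local_ring : Prop := exists! M : set A, is_maximal_ideal M.

Definition has_prime_chain (d : nat) : Prop :=
  exists P : 'I_d.+1 -> set A,
    (forall i, is_prime_ideal (P i)) /\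
    (forall i j : 'I_d.+1, (i < j)%N -> P i `<` P j).

Definition has_krull_dim (d : nat) : Prop :=
  has_prime_chain d /\ ~ has_prime_chain d.+1.

Definition jacobson_radical : set A :=
  [set x | forall M : set A, is_maximal_ideal M -> M x].

Definition nilradical : set A := [set x | exists m : nat, x ^+ m = 0].

End Ideals.

Arguments jacobson_radical A : clear implicits.
Arguments nilradical A : clear implicits.

(* The direct product of the [S i] is carried by the dependent function type
   with pointwise operations, so that a ring morphism into it is a family of
   ring morphisms into the factors. *)
Definition is_direct_product (A : comNzRingType) (I : finType)
    (S : I -> comNzRingType) : Prop :=
  exists f : forall i : I, {rmorphism A -> S i},
    bijective ((fun x i => f i x) : A -> (forall i : I, S i)).

Record commSubring (B : nzRingType) := CommSubring {
  comm_subring_set :> set B;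
  comm_subring_closed : subring_closed [in comm_subring_set];
  comm_subring_comm : {in comm_subring_set &, commutative *%R}
}.

Definition is_maximal_comm_subring (B : nzRingType) (R : commSubring B) : Prop :=
  forall R' : commSubring B, R `<=` R' -> R' = R :> set B.

Section SubringType.
Variables (B : nzRingType) (R : commSubring B).

Record ring_of : Type := RingOf {
  ring_of_val : B;
  ring_of_valP : ring_of_val \in (R : set B)
}.

HB.instance Definition _ := [isSub for ring_of_val].
HB.instance Definition _ := [Choice of ring_of by <:].
HB.instance Definition _ := GRing.SubChoice_isSubNzRing.Build B _ ring_of
  (comm_subring_closed R).

Fact ring_of_mulC : @commutative ring_of ring_of *%R.
Proof.
move=> x y; apply: val_inj; rewrite !rmorphM.
by apply: (comm_subring_comm (valP x) (valP y)).
Qed.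

HB.instance Definition _ :=
  GRing.PzRing_hasCommutativeMul.Build ring_of ring_of_mulC.

End SubringType.

(* Main.v *)
Require Import Defs.
From HB Require Import structures.
From mathcomp Require Import all_boot all_algebra.
From mathcomp Require Import boolp classical_sets.

Set Implicit Arguments.
Unset Strict Implicit.
Unset Printing Implicit Defensive.

Import GRing.Theory.

Local Open Scope classical_set_scope.
Local Open Scope ring_scope.

(** View a maximal commutative subring R of the matrix ring as a ring of
    endomorphisms of the left D-space of row vectors.  Maximality makes R equal
    to its own centralizer ([maximal_comm_subring_centralizer]), so anything
    built canonically from an element of R lies in R again.

    Fitting's lemma supplies such a construction: for m large, the space is the
    direct sum of the kernel and the image of A^m, and the inverse of A^m on
    its image, extended by 0 on the kernel, commutes with everything that
    commutes with A.  So each x in R satisfies x^m = x^m x^m b for some m > 0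
    and some b in R ([matrix_pi_regular], [ring_of_pi_regular]): R is strongly
    pi-regular, and x^m b is an idempotent.

    In a commutative strongly pi-regular ring, let e be a primitive idempotent.
    Then x e is nilpotent or x divides e, according to whether the idempotent
    x^m b e is 0 or e ([primitive_nil_or_invertible]).  Hence the corner ring
    of e consists of nilpotent and invertible elements, which makes it local
    with a single prime ideal.

    Primitive idempotents are reached because n+1 nonzero orthogonal idempotent
    matrices cannot exist in size n: their partial sums have strictly growing
    images ([orthogonal_idempotents_bound]).  A longest decomposition of 1 thus
    exists, its members are primitive, and R is the product of their corners.
    Finally, for each member e the x with x e nilpotent form a maximal ideal;
    an x in all of these is the sum of the nilpotents x e, which gives the
    equality of the two radicals ([jacobson_eq_nilradical]).

    All of this needs only a dimension for subspaces of row vectors that is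
    strictly monotone; over a noncommutative D the number of pivots serves. *)

(** * Dimension over a division ring *)

Lemma monotone_bounded_stationary (f : nat -> nat) b :
  {homo f : i j / (i <= j)%N} -> (forall i, f i <= b)%N ->
  exists N, forall i, (N <= i)%N -> f i = f N.
Proof.
move=> f_mono f_le.
have [] := @ex_maxnP (fun y => `[< exists i, f i = y >]) b.
- by exists (f 0%N); apply/asboolP; exists 0%N.
- by move=> y /asboolP[i <-].
move=> y /asboolP[N fN] y_max; exists N => i Ni.
apply/eqP; rewrite eqn_leq (f_mono N i Ni) andbT fN.
by apply: y_max; apply/asboolP; exists i.
Qed.

Section Dimension.
Variables (D : unitRingType) (divD : forall x : D, x != 0 -> x \is a GRing.unit).
Variable n : nat.
Implicit Types (V W : set 'rV[D]_n) (A B X : 'M[D]_n).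

Definition is_subspace V : Prop :=
  V 0 /\ forall (a : D) u v, V u -> V v -> V (a *: u + v).

Definition pivot V (j : 'I_n) : Prop :=
  exists2 v, V v & v 0 j != 0 /\ forall i : 'I_n, (i < j)%N -> v 0 i = 0.

(** The number of pivots is the number of nonzero rows in an echelon basis,
    that is, the usual dimension; it is defined here without choosing a basis,
    and for arbitrary subsets. *)
Definition dim V : nat := #|[pred j | `[< pivot V j >]]|.

Lemma dim_bound V : (dim V <= n)%N.
Proof. by rewrite -[leqRHS]card_ord max_card. Qed.

Lemma dim_pivotS V W : V `<=` W ->
  [pred j | `[< pivot V j >]] \subset [pred j | `[< pivot W j >]].
Proof.
move=> sVW; apply/fintype.subsetP => j /asboolP[v Vv vj].
by apply/asboolP; exists v; first exact: sVW.
Qed.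

Lemma dimS V W : V `<=` W -> (dim V <= dim W)%N.
Proof. by move=> /dim_pivotS /subset_leq_card. Qed.

(** Equal dimensions force equal pivots, and then a vector of W is reduced to 0
    by Gaussian elimination against vectors of V.  This is the only place where
    nonzero scalars have to be inverted. *)
Lemma dim_subset_eq V W : is_subspace V -> is_subspace W ->
  V `<=` W -> (dim W <= dim V)%N -> W `<=` V.
Proof.
move=> [V0 Vlin] [_ Wlin] sVW dWV.
have pivWV : [pred j | `[< pivot W j >]] \subset [pred j | `[< pivot V j >]].
  have := subset_leqif_card (dim_pivotS sVW).
  by move=> [_ <-]; rewrite eqn_leq (dimS sVW).
suff main d (w : 'rV[D]_n) :
    (forall i : 'I_n, (i + d < n)%N -> w 0 i = 0) -> W w -> V w.
  by move=> w; apply: (main n w) => i; rewrite ltnNge leq_addl.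
elim: d w => [|d IHd] w w0 Ww.
  suff -> : w = 0 by [].
  by apply/rowP => i; rewrite mxE w0 // addn0.
have [dn|nd] := ltnP d n; last first.
  by apply: IHd => // i /(leq_ltn_trans (leq_addl _ _)); rewrite ltnNge nd.
(* Since at most the last d + 1 entries of w are nonzero, j is the first
   position where w may be nonzero; it is cleared with a vector of V. *)
have jP : (n - d.+1 < n)%N by rewrite ltn_subrL (leq_ltn_trans _ dn).
pose j := Ordinal jP.
have w_lt (i : 'I_n) : (i < j)%N -> w 0 i = 0.
  by move=> ij; apply: w0; rewrite addnC -ltn_subRL.
have w_step (u : 'rV_n) : (forall i : 'I_n, (i < j)%N -> u 0 i = 0) ->
    u 0 j = 0 -> forall i : 'I_n, (i + d < n)%N -> u 0 i = 0.
  move=> ult uj i id_n.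
  have : (i <= j)%N by rewrite /= leq_subRL // addSn addnC.
  by rewrite leq_eqVlt => /orP[/eqP/val_inj->|/ult].
have [wj|wj] := eqVneq (w 0 j) 0; first by apply: IHd Ww; apply: w_step.
have : j \in [pred j | `[< pivot W j >]] by apply/asboolP; exists w.
move=> /(fintype.subsetP pivWV) /asboolP[v Vv [vj v_lt]].
pose c := w 0 j / v 0 j.
have Vdiff : V ((- c) *: v + w).
  apply: IHd; last by apply: Wlin => //; apply: sVW.
  apply: w_step => [i ij|]; first by rewrite !mxE v_lt // w_lt // mulr0 addr0.
  by rewrite !mxE mulNr divrK ?divD // addNr.
have -> : w = c *: v + ((- c) *: v + w) by rewrite scaleNr addrA subrr add0r.
exact: Vlin.
Qed.

Definition image A : set 'rV[D]_n := [set v | exists u, v = u *m A].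
Definition kernel A : set 'rV[D]_n := [set v | v *m A = 0].

Lemma image_subspace A : is_subspace (image A).
Proof.
split=> [|a _ _ [u ->] [v ->]]; first by exists 0; rewrite mul0mx.
by exists (a *: u + v); rewrite mulmxDl scalemxAl.
Qed.

Lemma kernel_subspace A : is_subspace (kernel A).
Proof.
split=> [|a u v /= uA vA]; first by rewrite /kernel /= mul0mx.
by rewrite /kernel /= mulmxDl -scalemxAl uA vA scaler0 addr0.
Qed.

Lemma image_mul A B : image (A * B) `<=` image B.
Proof. by move=> _ [u ->]; exists (u *m A); rewrite -mulmxA. Qed.

Lemma kernel_mul A B : kernel A `<=` kernel (A * B).
Proof. by move=> u /= uA; rewrite /kernel /= -mulmxE mulmxA uA mul0mx. Qed.

Lemma image_factor A B : image A `<=` image B -> exists X, A = X * B.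
Proof.
move=> sAB; have /fin_all_exists[x xP] (i : 'I_n) : exists u, row i A = u *m B.
  by apply: sAB; exists (delta_mx 0 i); rewrite rowE.
exists (\matrix_i x i); apply/row_matrixP => i.
by rewrite row_mul rowK.
Qed.

Lemma kernel_cancel A B : kernel B `<=` kernel A ->
  forall X, X * B = 0 -> X * A = 0.
Proof.
move=> sBA X XB; apply/row_matrixP => i; rewrite row_mul row0.
by apply: sBA; rewrite /kernel /= -row_mul mulmxE XB row0.
Qed.

(** The images of the powers of A decrease and the kernels increase; as their
    dimensions lie between 0 and n, both are constant from some exponent on. *)
Lemma power_image_kernel_stationary A : exists m,
  image (A ^+ m.+1) `<=` image (A ^+ m.+1 * A ^+ m.+1) /\
  kernel (A ^+ m.+1 * A ^+ m.+1) `<=` kernel (A ^+ m.+1).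
Proof.
have imS i j : (i <= j)%N -> image (A ^+ j) `<=` image (A ^+ i).
  by move=> /subnK <-; rewrite exprD; apply: image_mul.
have kerS i j : (i <= j)%N -> kernel (A ^+ i) `<=` kernel (A ^+ j).
  by move=> /subnKC <-; rewrite exprD; apply: kernel_mul.
have [p pP] := @monotone_bounded_stationary (fun i => dim (kernel (A ^+ i))) n
  (fun i j ij => dimS (kerS i j ij)) (fun i => dim_bound _).
have [|q qP] := @monotone_bounded_stationary
  (fun i => (n - dim (image (A ^+ i)))%N) n _ (fun i => leq_subr _ _).
  by move=> i j ij; rewrite leq_sub2l // dimS //; apply: imS.
have le_im i j : (q <= i)%N -> (q <= j)%N ->
    (dim (image (A ^+ i)) <= dim (image (A ^+ j)))%N.
  move=> qi qj; rewrite -[leqLHS](subKn (dim_bound _)).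
  by rewrite -[leqRHS](subKn (dim_bound _)) (qP i) // (qP j).
have pm : (p <= (p + q).+1)%N by rewrite leqW ?leq_addr.
have qm : (q <= (p + q).+1)%N by rewrite leqW ?leq_addl.
have mm : ((p + q).+1 <= (p + q).+1 + (p + q).+1)%N by rewrite leq_addr.
exists (p + q)%N; rewrite -exprD; split.
  apply: (dim_subset_eq (image_subspace _) (image_subspace _)) => //.
    exact: imS.
  by apply: le_im => //; apply: leq_trans mm.
apply: (dim_subset_eq (kernel_subspace _) (kernel_subspace _)).
  exact: kerS.
by rewrite pP ?[in leqRHS]pP //; apply: leq_trans mm.
Qed.

(** The image of the sum s of the first j idempotents lies in that of the next
    sum, and the inclusion is strict: if e i = X s then e i = e i * e i =
    X s (e i) = 0.  So each idempotent raises the dimension by at least 1. *)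
Lemma orthogonal_idempotents_bound k (e : 'I_k -> 'M[D]_n) :
  (forall i j, e i * e j = e i *+ (i == j)) -> (forall i, e i != 0) ->
  (k <= n)%N.
Proof.
move=> eM e0; pose s j := \sum_(i < k | (i < j)%N) e i.
suff dim_s j : (j <= k)%N -> (j <= dim (image (s j)))%N.
  exact: leq_trans (dim_s k (leqnn k)) (dim_bound _).
elim: j => // j IHj jk; apply: leq_ltn_trans (IHj (ltnW jk)) _.
pose i := Ordinal jk.
have sS : s j.+1 = e i + s j.
  rewrite /s (bigD1 i) //=; congr (_ + _); apply: eq_bigl => l.
  by rewrite ltnS ltn_neqAle andbC -val_eqE.
have sei : s j * e i = 0.
  rewrite /s mulr_suml big1 // => l lj; rewrite eM.
  by rewrite -val_eqE /= ltn_eqF.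
have eis : e i * s j = 0.
  rewrite /s mulr_sumr big1 // => l lj; rewrite eM.
  by rewrite -val_eqE /= gtn_eqF.
have ss : s j * s j = s j.
  rewrite /s mulr_suml; apply: eq_bigr => l lj; rewrite mulr_sumr (bigD1 l) //=.
  rewrite eM eqxx big1 ?addr0 // => h /andP[_ /negPf hl].
  by rewrite eM eq_sym hl.
have s_sub : image (s j) `<=` image (s j.+1).
  have {1}-> : s j = s j * s j.+1 by rewrite sS mulrDr sei add0r.
  exact: image_mul.
rewrite ltnNge; apply/negP.
move=> /(dim_subset_eq (image_subspace _) (image_subspace _) s_sub) sub.
have [X eX] : exists X, e i = X * s j.
  apply: image_factor; apply: subset_trans sub.
  have {1}-> : e i = e i * s j.+1 by rewrite sS mulrDr eis addr0 eM eqxx.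
  exact: image_mul.
have ei : e i = e i * e i by rewrite eM eqxx.
by have := e0 i; rewrite ei {1}eX -mulrA sei mulr0 eqxx.
Qed.

End Dimension.

(** * Strong pi-regularity *)

(** The two hypotheses say that, acting on the right, a maps its image onto
    itself and has no kernel there.  Then e = x a is the projection onto the
    image along the kernel, and b = e x e, the group inverse of a, inverts a on
    the image.  Since b is determined by a, it commutes with whatever commutes
    with a. *)
Lemma group_inverse (B : pzRingType) (a x : B) :
  a = x * (a * a) -> (forall r, r * (a * a) = 0 -> r * a = 0) ->
  exists b, a = a * a * b /\ forall c, c * a = a * c -> c * b = b * c.
Proof.
move=> axaa cancel_a.
have axa : a * x * a = a.
  apply/eqP; rewrite -subr_eq0 -{3}[a]mul1r -mulrBl; apply/eqP/cancel_a.
  by rewrite mulrBl mul1r -mulrA -axaa subrr.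
have [e eE] : exists e, e = x * a by exists (x * a).
have ea : e * a = a by rewrite eE -mulrA -axaa.
have ae : a * e = a by rewrite eE mulrA axa.
have ee : e * e = e by rewrite {2}eE mulrA eE -[_ * a * x]mulrA -mulrA axa.
have [b bE] : exists b, b = e * x * e by exists (e * x * e).
have ba : b * a = e by rewrite bE -mulrA ea -mulrA -eE.
have ab : a * b = e.
  rewrite bE !mulrA ae.
  have : (a * x * x - x) * a = 0.
    apply: cancel_a; rewrite mulrBl -axaa -[_ * x * _]mulrA -axaa axa.
    by rewrite subrr.
  by move=> /eqP; rewrite mulrBl subr_eq0 -eE -mulrA -eE => /eqP.
have eb : e * b = b by rewrite bE !mulrA ee.
have be : b * e = b by rewrite bE -mulrA ee.
exists b; split=> [|c ca]; first by rewrite -mulrA ab ae.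
have ece_l : e * c * e = e * c.
  by rewrite -{1 3}ba -(mulrA b a c) -ca -!mulrA ae.
have ece_r : e * c * e = c * e.
  by rewrite -{2 3}ab !mulrA -(mulrA e c a) ca (mulrA e a c) ea.
have ec : e * c = c * e by rewrite -ece_l.
by rewrite -{1}eb mulrA -ec -{1}ba -(mulrA b a c) -ca -!mulrA ab -ec mulrA be.
Qed.

Lemma matrix_pi_regular (D : unitRingType)
    (divD : forall x : D, x != 0 -> x \is a GRing.unit) n (A : 'M[D]_n) :
  exists m (b : 'M[D]_n), A ^+ m.+1 = A ^+ m.+1 * A ^+ m.+1 * b /\
    forall c, c * A = A * c -> c * b = b * c.
Proof.
have [m [im_sub ker_sub]] := power_image_kernel_stationary divD A.
have [X AX] := image_factor im_sub.
have [b [Ab comm_b]] := group_inverse AX (kernel_cancel ker_sub).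
exists m, b; split=> // c cA; apply: comm_b.
exact: (@commrX _ c A m.+1 cA).
Qed.

(** * Commutative pi-regular rings *)

Section CommutativeRings.
Implicit Type A : comNzRingType.

Definition pi_regular A : Prop :=
  forall x : A, exists m b, x ^+ m.+1 = x ^+ m.+1 * x ^+ m.+1 * b.

Definition primitive A (e : A) : Prop :=
  [/\ e * e = e, e != 0 & forall f, f * f = f -> f * e = f -> f = 0 \/ f = e].

(** In terms of the corner ring of an idempotent e: each of its elements is
    nilpotent or invertible.  Phrasing it inside A lets the same notion serve
    for A (with e = 1) and for a corner. *)
Definition nil_or_invertible A (e : A) : Prop :=
  forall x, nilradical A (x * e) \/ exists c, x * c = e.

Lemma nilradical0 A : nilradical A 0.
Proof. by exists 1%N; rewrite expr1. Qed.

Lemma nilradicalD A x y :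
  nilradical A x -> nilradical A y -> nilradical A (x + y).
Proof.
move=> [p xp] [q yq]; exists (p + q)%N; rewrite exprDn big1 // => i _.
have [iq|qi] := ltnP i q.
  have pi : (p <= p + q - i)%N by rewrite -addnBA ?leq_addr // ltnW.
  by rewrite -(subnK pi) exprD xp mulr0 mul0r mul0rn.
by rewrite -(subnK qi) exprD yq !mulr0 mul0rn.
Qed.

Lemma nilradicalM A a x : nilradical A x -> nilradical A (a * x).
Proof. by move=> [p xp]; exists p; rewrite exprMn xp mulr0. Qed.

Lemma nilradical_idempotent A (e : A) :
  e * e = e -> nilradical A e -> e = 0.
Proof.
move=> ee [p ep].
have eX k : e ^+ k.+1 = e by elim: k => [|k IHk]; rewrite ?expr1 // exprS IHk.
by rewrite -(eX p) exprS ep mulr0.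
Qed.

Lemma nil_sub1_unit A (x : A) : nilradical A x -> exists c, c * (1 - x) = 1.
Proof.
move=> [p xp]; exists (\sum_(i < p) x ^+ i).
rewrite mulrC -[1 - x]opprB mulNr -subrX1 xp.
by rewrite sub0r opprK.
Qed.

Lemma proper_idealP A (I : set A) : is_proper_ideal I <->
  [/\ I 0, ~ I 1 & forall a u v, I u -> I v -> I (a * u + v)].
Proof.
split=> [[]|[I0 I1 Ilin]].
  rewrite !inE => I0 /negP I1 Ilin; split=> // [I1'|a u v Iu Iv].
    by apply: I1; rewrite inE.
  by have := Ilin a u v; rewrite !inE; apply.
split; rewrite ?inE //; first by apply/negP; rewrite inE.
by move=> a u v; rewrite !inE; apply: Ilin.
Qed.

(** Adding the nilradical to M keeps it proper: if 1 = u + z with u in M and z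
    nilpotent, then u = 1 - z is invertible. *)
Lemma maximal_ideal_nilradical A (M : set A) :
  is_maximal_ideal M -> nilradical A `<=` M.
Proof.
move=> [/proper_idealP[M0 M1 Mlin] M_max] x x_nil.
pose I : set A :=
  [set y | exists2 u, M u & exists2 z, nilradical A z & y = u + z].
suff I_proper : is_proper_ideal I.
  rewrite -(M_max I I_proper) => [|u Mu].
    by exists 0 => //; exists x; rewrite ?add0r.
  by exists u => //; exists 0; rewrite ?addr0 //; exact: nilradical0.
apply/proper_idealP; split.
- by exists 0 => //; exists 0; rewrite ?addr0 //; exact: nilradical0.
- move=> [u Mu [z z_nil oneE]].
  have [c] := nil_sub1_unit z_nil.
  rewrite [in 1 - z]oneE addrK => c1.
  by apply: M1; rewrite -c1 -[c * u]addr0; apply: Mlin.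
- move=> a _ _ [u Mu [y y_nil ->]] [v Mv [z z_nil ->]].
  exists (a * u + v); first exact: Mlin.
  exists (a * y + z); first by apply: nilradicalD => //; apply: nilradicalM.
  by rewrite mulrDr addrACA.
Qed.

(** With x^m = x^m x^m b and m > 0, the element x^m b e is an idempotent below
    e.  If it is 0 then (x e)^m = x^m (x^m b e) e^(m-1) = 0; if it is e then x
    divides e. *)
Lemma primitive_nil_or_invertible A (e : A) :
  pi_regular A -> primitive e -> nil_or_invertible e.
Proof.
move=> A_reg [ee _ e_prim] x; have [m [b xb]] := A_reg x.
set a := x ^+ m.+1 in xb.
have ab_idem : (a * b) * (a * b) = a * b by rewrite mulrACA mulrA -xb.
have [||abe0|abeE] := e_prim (a * b * e).
- by rewrite mulrACA ab_idem ee.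
- by rewrite -mulrA ee.
- left; exists m.+1; rewrite exprMn -/a xb -(mulrA a a b) exprS mulrA.
  by rewrite -[a * (a * b) * e]mulrA abe0 mulr0 mul0r.
- by right; exists (x ^+ m * b * e); rewrite !mulrA -exprS.
Qed.

(** This is the preimage in A of the nilradical of the corner ring of e.  An
    ideal I above it contains 1 - e, and if it has an element outside then it
    also contains e, hence 1. *)
Lemma nil_or_invertible_maximal A (e : A) :
  e * e = e -> e != 0 -> nil_or_invertible e ->
  is_maximal_ideal [set x | nilradical A (x * e)].
Proof.
move=> ee e0 e_dich; split.
  apply/proper_idealP; split => /=.
  - by rewrite mul0r; exact: nilradical0.
  - by rewrite mul1r => /(nilradical_idempotent ee)/eqP; rewrite (negPf e0).
  - move=> a u v ue ve; rewrite mulrDl -mulrA.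
    by apply: nilradicalD => //; apply: nilradicalM.
move=> I /proper_idealP[I0 I1 Ilin] sMI; apply/seteqP; split=> // y Iy /=.
have [//|[c ycE]] := e_dich y; case: I1.
have I1e : I (1 - e).
  by apply: sMI; rewrite /= mulrBl mul1r ee subrr; exact: nilradical0.
by rewrite -(subrK e 1) addrC -ycE mulrC; apply: Ilin => //; rewrite mulrC ycE.
Qed.

(** Proper ideals contain no invertible element and prime ideals contain all
    nilpotents, so the nilradical is the only prime ideal and contains every
    proper ideal. *)
Lemma nil_or_invertible_local A : nil_or_invertible (1 : A) ->
  is_local_ring A /\ has_krull_dim A 0.
Proof.
move=> A_dich.
have nil_max : is_maximal_ideal (nilradical A).
  have := nil_or_invertible_maximal (mulr1 1) (oner_neq0 A) A_dich.
  by congr is_maximal_ideal; apply/funext => x /=; rewrite mulr1.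
have sub_nil (I : set A) : is_proper_ideal I -> I `<=` nilradical A.
  move=> /proper_idealP[I0 I1 Ilin] x Ix.
  have [|[c xc]] := A_dich x; first by rewrite mulr1.
  by case: I1; rewrite -xc mulrC -[c * x]addr0; apply: Ilin.
have [nil_proper _] := nil_max.
split.
  exists (nilradical A); split=> // M [M_proper M_max].
  by apply: M_max => //; apply: sub_nil.
have prime_nil (P : set A) : is_prime_ideal P -> P = nilradical A.
  move=> [P_proper P_prime]; apply/seteqP; split; first exact: sub_nil.
  have /proper_idealP[P0 P1 _] := P_proper.
  move=> x [p xp]; have {xp} : P (x ^+ p) by rewrite xp.
  elim: p => [|p IHp]; first by rewrite expr0.
  rewrite exprS => Pxp.
  by have /orP[/set_mem|/set_mem] := P_prime _ _ (mem_set Pxp).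
split.
  exists (fun=> nilradical A); split=> [_|[[|i] ?] [[|j] ?]] //.
  split=> // u v /set_mem uv; apply/orP; have [|[c uc]] := A_dich u.
    by rewrite mulr1; left; apply: mem_set.
  right; apply: mem_set.
  have -> : v = c * (u * v) by rewrite mulrA [c * u]mulrC uc mul1r.
  exact: nilradicalM.
move=> [P [P_prime P_lt]].
have := P_lt ord0 ord_max isT.
by rewrite !(prime_nil _ (P_prime _)) => -[].
Qed.

(** * Splitting off orthogonal idempotents *)

Definition complete_orthogonal A k (e : 'I_k -> A) : Prop :=
  [/\ forall i j, e i * e j = e i *+ (i == j), forall i, e i != 0
    & \sum_i e i = 1].

(** An idempotent f strictly between 0 and e i0 refines the decomposition:
    e i0 is replaced by e i0 - f, and f is put in front. *)
Lemma complete_orthogonal_split A k (e : 'I_k -> A) (i0 : 'I_k) (f : A) :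
  complete_orthogonal e -> f * f = f -> f * e i0 = f -> f != 0 -> f != e i0 ->
  exists e' : 'I_k.+1 -> A, complete_orthogonal e'.
Proof.
move=> [eM e0 e1] ff fe f0 fN.
pose g i := e i - f *+ (i == i0).
have fM i : f * e i = f *+ (i == i0).
  by rewrite -{1}fe -mulrA eM mulrnAr fe eq_sym.
have fg i : f * g i = 0 by rewrite mulrBr fM mulrnAr ff subrr.
have gM i j : g i * g j = g i *+ (i == j).
  rewrite {1}/g mulrBl mulrnAl fg mul0rn subr0 mulrBr eM mulrnAr mulrC fM.
  rewrite mulrnBl; congr (_ - _); have [->|ij] := eqVneq i j.
    by case: eqP; rewrite ?mulr0n ?mulr1n.
  by case: (eqVneq j i0) ij => [->|_ _] => [/negPf->|]; rewrite ?mulr0n.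
exists (fun l => oapp g f (unlift ord0 l)); split.
- move=> i j; have [i'|] := unliftP ord0 i => ->;
    have [j'|] := unliftP ord0 j => -> /=.
  + by rewrite gM (inj_eq lift_inj).
  + by rewrite mulrC fg.
  + by rewrite fg.
  + exact: ff.
- move=> i; have [i'|] := unliftP ord0 i => _ //=.
  rewrite /g; have [->|_] := eqVneq i' i0; last by rewrite subr0.
  by rewrite subr_eq0 eq_sym.
- rewrite big_ord_recl unlift_none /=.
  under eq_bigr do rewrite liftK /=.
  rewrite /g sumrB e1 (bigD1 i0) //= eqxx big1 => [|i /negPf-> //].
  by rewrite addr0 addrC subrK.
Qed.

(** A decomposition of 1 of maximal length cannot be refined. *)
Lemma exists_primitive_decomposition A b :
  (forall k (e : 'I_k -> A), complete_orthogonal e -> (k <= b)%N) ->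
  exists k (e : 'I_k -> A), [/\ (k <= b)%N, complete_orthogonal e
    & forall i, primitive (e i)].
Proof.
move=> bound.
have [] := @ex_maxnP
  (fun k => `[< exists e : 'I_k -> A, complete_orthogonal e >]) b.
- exists 1%N; apply/asboolP; exists (fun=> 1); split.
  + by move=> i j; rewrite !ord1 eqxx mulr1.
  + by move=> _; exact: oner_neq0.
  + by rewrite big_ord1.
- by move=> k /asboolP[e /bound].
move=> k /asboolP[e eP] k_max; exists k, e; split=> //; first exact: bound eP.
have [eM e0 e1] := eP.
move=> i; split=> //; first by rewrite eM eqxx.
move=> f ff fe; have [f0|f0] := eqVneq f 0; first by left.
right; apply/eqP; apply: contraT => fN.
have [e' e'P] := complete_orthogonal_split eP ff fe f0 fN.
have /k_max : `[< exists e : 'I_k.+1 -> A, complete_orthogonal e >].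
  by apply/asboolP; exists e'.
by rewrite ltnn.
Qed.

(** An x in the Jacobson radical lies in the maximal ideals of
    [nil_or_invertible_maximal], one for each e i, so x = sum_i x (e i) is a
    sum of nilpotents. *)
Lemma jacobson_eq_nilradical A k (e : 'I_k -> A) :
  complete_orthogonal e -> (forall i, nil_or_invertible (e i)) ->
  jacobson_radical A = nilradical A.
Proof.
move=> [eM e0 e1] e_dich; apply/seteqP; split=> x.
  move=> xJ; rewrite -[x]mulr1 -e1 mulr_sumr.
  apply: (big_ind (nilradical A)); first exact: nilradical0.
    exact: nilradicalD.
  move=> i _; apply: (xJ [set x | nilradical A (x * e i)]).
  by apply: nil_or_invertible_maximal; rewrite // eM eqxx.
by move=> x_nil M M_max; apply: maximal_ideal_nilradical x_nil.
Qed.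

End CommutativeRings.

(** * Corner rings *)

(** Bundling the proofs lets the corner be a type with a canonical ring
    structure, which is nontrivial because its unit e is nonzero. *)
Record nz_idempotent (A : comNzRingType) := NzIdempotent {
  idem_val : A;
  idem_mul : idem_val * idem_val = idem_val;
  idem_neq0 : idem_val != 0
}.

Section Corner.
Variables (A : comNzRingType) (E : nz_idempotent A).
Local Notation e := (idem_val E).

Definition corner_pred : {pred A} := [pred x : A | x * e == x].

Lemma corner_pred_zmod : zmod_closed corner_pred.
Proof.
split=> [|x y]; rewrite !inE ?mul0r // => /eqP xe /eqP ye.
by rewrite mulrBl xe ye.
Qed.

Record corner : Type := Corner {
  corner_val : A;
  corner_valP : corner_val \in corner_pred
}.

HB.instance Definition _ := [isSub for corner_val].
HB.instance Definition _ := [Choice of corner by <:].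
HB.instance Definition _ :=
  GRing.SubChoice_isSubZmodule.Build A corner_pred corner corner_pred_zmod.

Lemma corner_val_inj : injective corner_val.
Proof. exact: val_inj. Qed.

Lemma corner_valE (x : corner) : corner_val x * e = corner_val x.
Proof. exact/eqP/(corner_valP x). Qed.

Lemma corner_proj_subproof (x : A) : x * e \in corner_pred.
Proof. by rewrite inE -mulrA idem_mul. Qed.

Definition corner_proj (x : A) : corner := Corner (corner_proj_subproof x).

Definition corner_one : corner := corner_proj 1.
(** The projection does not change the product; it spares a closure proof. *)
Definition corner_mul (x y : corner) : corner :=
  corner_proj (corner_val x * corner_val y).

Lemma corner_mulE x y :
  corner_val (corner_mul x y) = corner_val x * corner_val y.
Proof. by rewrite /= -mulrA corner_valE. Qed.

Lemma corner_mulA : associative corner_mul.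
Proof. by move=> x y z; apply: corner_val_inj; rewrite !corner_mulE mulrA. Qed.

Lemma corner_mulC : commutative corner_mul.
Proof. by move=> x y; apply: corner_val_inj; rewrite !corner_mulE mulrC. Qed.

Lemma corner_mul1 : left_id corner_one corner_mul.
Proof.
move=> x; apply: corner_val_inj.
by rewrite corner_mulE /= mul1r mulrC corner_valE.
Qed.

Lemma corner_mulDl : left_distributive corner_mul +%R.
Proof. by move=> x y z; apply: val_inj; rewrite /= !mulrDl. Qed.

Lemma corner_one_neq0 : corner_one != 0.
Proof.
apply/eqP => /(congr1 corner_val) /=; rewrite mul1r => /eqP.
by rewrite (negPf (idem_neq0 E)).
Qed.

HB.instance Definition _ := GRing.Zmodule_isComNzRing.Build corner
  corner_mulA corner_mulC corner_mul1 corner_mulDl corner_one_neq0.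

Lemma corner_proj_zmod : zmod_morphism corner_proj.
Proof. by move=> x y; apply: val_inj; rewrite /= mulrBl. Qed.

Lemma corner_proj_monoid : monoid_morphism corner_proj.
Proof.
split=> // x y; apply: corner_val_inj; rewrite corner_mulE /=.
by rewrite mulrACA idem_mul.
Qed.

HB.instance Definition _ :=
  GRing.isZmodMorphism.Build A corner corner_proj corner_proj_zmod.
HB.instance Definition _ :=
  GRing.isMonoidMorphism.Build A corner corner_proj corner_proj_monoid.

Lemma corner_valK (x : corner) : corner_proj (corner_val x) = x.
Proof. by apply: val_inj; rewrite /= corner_valE. Qed.

Lemma corner_nil_or_invertible :
  nil_or_invertible e -> nil_or_invertible (1 : corner).
Proof.
move=> e_dich x; have [[m xm]|[c xc]] := e_dich (corner_val x).
  left; exists m; rewrite mulr1 -[x]corner_valK -rmorphXn /=.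
  by rewrite -[corner_val x]corner_valE xm rmorph0.
right; exists (corner_proj c); rewrite -{1}[x]corner_valK -rmorphM /= xc.
by apply: val_inj; rewrite /= idem_mul mul1r.
Qed.

End Corner.

(** The inverse of x |-> (x (e i))_i sums the components. *)
Lemma corner_direct_product (A : comNzRingType) k (e : 'I_k -> nz_idempotent A) :
  complete_orthogonal (fun i => idem_val (e i)) ->
  is_direct_product A (fun i => corner (e i)).
Proof.
move=> [eM _ e1]; exists (fun i => corner_proj (e i)).
exists (fun s => \sum_i corner_val (s i)) => [x|s] /=.
  by rewrite -mulr_sumr e1 mulr1.
apply: functional_extensionality_dep => i; apply: val_inj => /=.
rewrite mulr_suml (bigD1 i) //= corner_valE big1 ?addr0 // => j ji.
by rewrite -corner_valE -mulrA eM (negPf ji) mulr0n mulr0.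
Qed.

(** * Maximal commutative subrings *)

Section Centralizer.
Variable B : nzRingType.
Implicit Type X : set B.

Definition centralizer X : set B := [set x | forall y, X y -> x * y = y * x].

Lemma centralizer_subring X : subring_closed [in centralizer X].
Proof.
split; first by rewrite inE => y _; rewrite mul1r mulr1.
  move=> u v; rewrite !inE => uX vX y Xy.
  by rewrite mulrBl mulrBr uX // vX.
move=> u v; rewrite !inE => uX vX y Xy.
by rewrite -mulrA vX // mulrA uX // mulrA.
Qed.

(** If c centralizes R, then X, the set R with c added, is a commuting set, so
    X lies in its centralizer, and therefore the double centralizer of X is a
    commutative subring; it contains R and c.  This avoids describing the
    subring generated by X. *)
Lemma maximal_comm_subring_centralizer (R : commSubring B) :
  is_maximal_comm_subring R -> centralizer R `<=` R.
Proof.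
move=> R_max c cR; pose X := (R : set B) `|` [set c].
have X_comm : X `<=` centralizer X.
  have Rcomm x y : (R : set B) x -> (R : set B) y -> x * y = y * x.
    by move=> /mem_set Rx /mem_set Ry; apply: (comm_subring_comm Rx Ry).
  by move=> x [Rx|->] y [Ry|->] //; [exact: Rcomm | exact/esym/cR | exact: cR].
have XX_comm : {in centralizer (centralizer X) &, commutative *%R}.
  move=> x y; rewrite !inE => xXX yXX; apply: xXX => z Xz.
  by apply: yXX; apply: X_comm.
have X_sub : X `<=` centralizer (centralizer X).
  by move=> x Xx y yX; rewrite yX.
pose R' := CommSubring (centralizer_subring (centralizer X)) XX_comm.
have <- : R' = R :> set B by apply: R_max => x Rx; apply: X_sub; left.
by apply: X_sub; right.
Qed.

(** The witness b commutes with all of R, because R commutes with a. *)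
Lemma ring_of_pi_regular (R : commSubring B) : is_maximal_comm_subring R ->
  (forall a : B, exists m b, a ^+ m.+1 = a ^+ m.+1 * a ^+ m.+1 * b /\
    forall c, c * a = a * c -> c * b = b * c) ->
  pi_regular (ring_of R).
Proof.
move=> R_max B_reg x; have [m [b [xb b_comm]]] := B_reg (val x).
have Rb : b \in (R : set B).
  rewrite inE; apply: maximal_comm_subring_centralizer => // y Ry.
  apply/esym/b_comm; exact: (comm_subring_comm (mem_set Ry) (valP x)).
exists m, (RingOf Rb); apply: val_inj.
by rewrite !rmorphM !rmorphXn.
Qed.

End Centralizer.

Theorem theorem1p1 (D : unitRingType)
    (divD : forall x : D, x != 0 -> x \is a GRing.unit) (n : nat)
    (R : commSubring 'M[D]_n.+1) (maxR : is_maximal_comm_subring R) :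
  (exists (k : nat) (S : 'I_k -> comNzRingType),
     [/\ (k <= n.+1)%N,
         forall i : 'I_k, is_local_ring (S i) /\ has_krull_dim (S i) 0
       & is_direct_product (ring_of R) S]) /\
  jacobson_radical (ring_of R) = nilradical (ring_of R).
Proof.
have R_reg : pi_regular (ring_of R).
  by apply: ring_of_pi_regular => // a; apply: matrix_pi_regular.
have [|k [e [kn eP e_prim]]] := @exists_primitive_decomposition (ring_of R) n.+1.
  move=> k e [eM e0 _].
  apply: (@orthogonal_idempotents_bound D divD _ _ (fun i => val (e i))).
    by move=> i j; rewrite -rmorphM eM rmorphMn.
  move=> i; apply: contraNneq (e0 i) => ei0.
  by apply/eqP/val_inj; rewrite ei0 rmorph0.
have e_dich i : nil_or_invertible (e i).
  exact: primitive_nil_or_invertible.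
split; last exact: jacobson_eq_nilradical eP e_dich.
have [eM e0 _] := eP.
have e_idem i : e i * e i = e i by rewrite eM eqxx.
pose E i := NzIdempotent (e_idem i) (e0 i).
exists k, (fun i => corner (E i)); split=> //.
  by move=> i; apply/nil_or_invertible_local/corner_nil_or_invertible/e_dich.
exact: (@corner_direct_product _ _ E).
Qed.
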